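(* Let $\mathbb{F}$ be a field of characteristic zero, $q\in\mathbb{F}$ nonzero and not a root of unity, and let $T:\mathbb{N}\to\mathbb{F}$ be a $q$-hypergeometric term with a $q$-multiplicative representation $(D,U,n_0)$. Let $U_1,F,V\in\mathbb{F}(x)$ be the output of the following algorithm on input $(D,U,n_0)$: Set $d_1:=\mathrm{numer}(D)$, $d_2:=\mathrm{denom}(D)$, $U_1:=0$, $U_2:=U$, $u_2:=\mathrm{denom}(U)$, $N:=\mathrm{qdis}(u_2,u_2)$. For $h:=N$ down to $1$ do: $v_2:=u_2/\gcd(u_2,d_2)$; $s(x):=\gcd(v_2(x),v_2(q^{-h}x))$; $(\tilde s,\tilde u_2):=\mathrm{pump}(s,u_2)$; choose polynomials $a,b\in\mathbb{F}[x]$ with $U_2=a/\tilde u_2+b/\tilde s$; $U_1':=-b/\tilde s$; $U_1:=U_1+U_1'$; $U_2:=U_2-D\cdot\varepsilon U_1'+U_1'$; $u_2:=\mathrm{denom}(U_2)$. After the loop: $f_1:=d_1$; $v_1:=\mathrm{numer}(U_2)$; $v_2:=\mathrm{denom}(U_2)$; $w:=\gcd(d_2,v_2)$; $v_2:=v_2/w$; $f_2:=(\varepsilon w)\cdot d_2/w$; $F:=f_1/f_2$; $V:=\frac{1}{w(q^{n_0})}\cdot\frac{v_1}{v_2}$; return $(U_1,F,V)$. Here $\mathrm{pump}(f,g)$, for polynomials $f\mid g$, is: $\tilde f:=f$, $\tilde g:=g/f$; repeat $\{d:=\gcd(\tilde f,\tilde g);\ \tilde f:=\tilde f d;\ \tilde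 g:=\tilde g/d\}$ until $\deg d=0$; return $(\tilde f,\tilde g)$. Then there exist $q$-hypergeometric terms $T_1,T_2$ such that (1) $T(n)=T_1(n+1)-T_1(n)+T_2(n)$ for all $n\ge n_0$; (2) $T_1$ has $q$-multiplicative representation $(D,U_1,n_0)$ and $T_2$ has $q$-multiplicative representation $(F,V,n_0)$; (3) the denominator of $V$ is $\varepsilon$-free. Furthermore, if $D$ is $\varepsilon$-reduced, then so is $F$.
   Context: $x$ is transcendental over $\mathbb{F}$; $\varepsilon$ is the automorphism of $\mathbb{F}(x)$ fixing $\mathbb{F}$ with $\varepsilon x=qx$, so $(\varepsilon f)(x)=f(qx)$. For a rational function, $\mathrm{numer}$ and $\mathrm{denom}$ denote numerator and (monic) denominator of its reduced form; $\gcd$ is the monic gcd. A function $T:\mathbb{N}\to\mathbb{F}$ is a $q$-hypergeometric term if there exist $n_0\in\mathbb{N}$ and nonzero $R\in\mathbb{F}(x)$ with $T(n+1)=R(q^n)T(n)$ for all $n\ge n_0$. A triple $(D,U,n_0)$ with $D,U\in\mathbb{F}(x)$ is a $q$-multiplicative representation of $T$ if for all $n\ge n_0$, $D(q^n)$ is defined and nonzero, $U(q^n)$ is defined, and $T(n)=U(q^n)\prod_{j=n_0}^{n-1}D(q^j)$. For $u,v\in\mathbb{F}[x]$, let $\mathcal{R}$ be the set of nonnegative integers $h$ for which there is an irreducible polynomial $p(x)$, not associate to $x$, with $p(x)\mid u(x)$ and $p(x)\mid v(q^hx)$; $\mathrm{qdis}(u,v)=\max\mathcal{R}$, or $-1$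 if $\mathcal{R}=\emptyset$. A polynomial $v$ is $\varepsilon$-free if $\mathrm{qdis}(v,v)\le 0$, i.e. for no nonzero integer $h$ do $v(x)$ and $v(q^hx)$ share an irreducible factor other than $x$. A rational function $r/s$ ($r,s$ coprime polynomials) is $\varepsilon$-reduced if $\gcd(r(x),s(q^hx))=1$ for all $h\in\mathbb{Z}$. *)

(* Defs.v *)
From HB Require Import structures.
From mathcomp Require Import all_boot all_order all_algebra fraction generic_quotient.
From mathcomp Require Import boolp classical_sets.
Set Implicit Arguments.
Unset Strict Implicit.
Unset Printing Implicit Defensive.
Import Order.TTheory GRing.Theory Num.Theory.
Local Open Scope ring_scope.

Notation ratfun K := {fraction {poly K}}.
Notation "p %:F" := (@FracField.tofrac _ p) : ring_scope.

(* gcdp is only determined up to a nonzero constant; mgcd is the monic gcd. *)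
Definition mgcd (K : fieldType) (f g : {poly K}) : {poly K} :=
  (lead_coef (gcdp f g))^-1 *: gcdp f g.

(* repr f is an arbitrary pair representing f, hence the cancellation of the
   gcd and the normalisation of the leading coefficient; see ratfunP. *)
Definition denom (K : fieldType) (f : ratfun K) : {poly K} :=
  let d := \d_(repr f) %/ gcdp \n_(repr f) \d_(repr f) in
  (lead_coef d)^-1 *: d.

Definition numer (K : fieldType) (f : ratfun K) : {poly K} :=
  let g := gcdp \n_(repr f) \d_(repr f) in
  (lead_coef (\d_(repr f) %/ g))^-1 *: (\n_(repr f) %/ g).

(* p(c x) *)
Definition dilate (K : fieldType) (c : K) (p : {poly K}) : {poly K} :=
  p \Po (c *: 'X).

(* The automorphism of K(x) over K with x |-> q x (for q != 0);
   see eps_zmod_morphism, eps_monoid_morphism, epsC and epsX. *)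
Definition eps (K : fieldType) (q : K) (f : ratfun K) : ratfun K :=
  (dilate q (numer f))%:F / (dilate q (denom f))%:F.

Definition defined_at (K : fieldType) (f : ratfun K) (c : K) : Prop :=
  (denom f).[c] != 0.

(* Meaningful only when defined_at f c. *)
Definition value_at (K : fieldType) (f : ratfun K) (c : K) : K :=
  (numer f).[c] / (denom f).[c].

Definition q_hypergeometric (K : fieldType) (q : K) (T : nat -> K) : Prop :=
  exists n0 : nat, exists2 R : ratfun K, R != 0 &
    forall n, (n0 <= n)%N ->
      defined_at R (q ^+ n) /\ T n.+1 = value_at R (q ^+ n) * T n.

Definition q_mult_repr (K : fieldType) (q : K) (T : nat -> K)
    (D U : ratfun K) (n0 : nat) : Prop :=
  forall n, (n0 <= n)%N ->
    [/\ defined_at D (q ^+ n), value_at D (q ^+ n) != 0, defined_at U (q ^+ n)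
      & T n = value_at U (q ^+ n)
              * \prod_(n0 <= j < n) value_at D (q ^+ j)].

Definition qdis_set (K : fieldType) (q : K) (u v : {poly K}) (h : nat) : Prop :=
  exists p : {poly K},
    [/\ irreducible_poly p, ~~ (p %= 'X), p %| u & p %| dilate (q ^+ h) v].

(* The maximum of qdis_set, or -1 when there is no maximum.  For u, v nonzero
   and q nonzero and not a root of unity the set is finite, so "no maximum"
   then means "empty". *)
Definition qdis (K : fieldType) (q : K) (u v : {poly K}) : int :=
  xget (-1) [set m : int | exists h : nat,
    [/\ m = h%:Z, qdis_set q u v h
      & forall h', qdis_set q u v h' -> (h' <= h)%N]]%classic.

Definition eps_free (K : fieldType) (q : K) (v : {poly K}) : Prop :=
  qdis q v v <= 0.

Definition eps_reduced (K : fieldType) (q : K) (f : ratfun K) : Prop :=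
  forall h : int, mgcd (numer f) (dilate (q ^ h) (denom f)) = 1.

(* Big-step semantics of the body
   "repeat {d := gcd(f, g); f := f d; g := g / d} until deg d = 0". *)
Inductive pump_loop (K : fieldType) :
    {poly K} -> {poly K} -> {poly K} * {poly K} -> Prop :=
| PumpStop f g (d := mgcd f g) :
    size d = 1%N -> pump_loop f g (f * d, g %/ d)
| PumpNext f g r (d := mgcd f g) :
    size d <> 1%N -> pump_loop (f * d) (g %/ d) r -> pump_loop f g r.

Definition pump (K : fieldType) (f g : {poly K}) (r : {poly K} * {poly K}) :
    Prop :=
  pump_loop f (g %/ f) r.

(* One iteration, with counter h, on the state (U1, U2, u2).  It is a relation
   because the choice of a and b is free. *)
Definition iteration (K : fieldType) (q : K) (D : ratfun K) (h : int)
    (st st' : ratfun K * ratfun K * {poly K}) : Prop :=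
  let: (U1, U2, u2) := st in
  let d2 := denom D in
  let v2 := u2 %/ mgcd u2 d2 in
  let s := mgcd v2 (dilate (q ^ (- h)) v2) in
  exists st2 ut2 a b : {poly K},
    [/\ pump s u2 (st2, ut2),
        U2 = a%:F / ut2%:F + b%:F / st2%:F
      & let U1' := - (b%:F / st2%:F) in
        let U2' := U2 - D * eps q U1' + U1' in
        st' = (U1 + U1', U2', denom U2')].

(* "for h := N down to 1". *)
Inductive for_loop (K : fieldType) (q : K) (D : ratfun K) : int ->
    ratfun K * ratfun K * {poly K} -> ratfun K * ratfun K * {poly K} -> Prop :=
| ForStop h st : h < 1 -> for_loop q D h st st
| ForNext h st st1 st2 : 1 <= h -> iteration q D h st st1 ->
    for_loop q D (h - 1) st1 st2 -> for_loop q D h st st2.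

(* algorithm_output q D U n0 U1 F V: some run of the algorithm on (D, U, n0)
   returns (U1, F, V). *)
Definition algorithm_output (K : fieldType) (q : K) (D U : ratfun K) (n0 : nat)
    (U1 F V : ratfun K) : Prop :=
  let d1 := numer D in
  let d2 := denom D in
  let N := qdis q (denom U) (denom U) in
  exists U2 u2,
    for_loop q D N (0, U, denom U) (U1, U2, u2) /\
    (let f1 := d1 in
     let v1 := numer U2 in
     let w := mgcd d2 (denom U2) in
     let v2 := denom U2 %/ w in
     let f2 := dilate q w * d2 %/ w in
     F = f1%:F / f2%:F /\
     V = ((w.[q ^+ n0])^-1)%:P%:F * (v1%:F / v2%:F)).

Lemma ratfunP (K : fieldType) (f : ratfun K) :
  [/\ f = (numer f)%:F / (denom f)%:F, denom f \is monic
    & coprimep (numer f) (denom f)].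
Proof.
rewrite /numer /denom; set n := \n_(repr f); set d := \d_(repr f).
set g := gcdp n d; have d0 : d != 0 by apply: denom_ratioP.
have g0 : g != 0 by rewrite gcdp_eq0 negb_and d0 orbT.
have ng : n = n %/ g * g by rewrite divpK ?dvdp_gcdl.
have dg : d = d %/ g * g by rewrite divpK ?dvdp_gcdr.
have dg0 : d %/ g != 0 by move: d0; rewrite {1}dg mulf_eq0 negb_or => /andP[].
set l := (lead_coef _)^-1.
have l0 : l != 0 by rewrite invr_eq0 lead_coef_eq0.
have fE : f = n%:F / d%:F.
  have dF0 : d%:F != 0 by rewrite tofrac_eq0.
  apply: (mulIf dF0); rewrite divfK // -[f in LHS]reprK.
  rewrite /n /d; move: (repr f) (denom_ratioP (repr f)) => r r0.
  unlock FracField.tofrac; rewrite -[LHS]FracField.pi_mul; apply/eqmodP.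
  rewrite /= FracField.equivfE /FracField.mulf /= !numden_Ratio ?mulf_neq0 ?oner_eq0 //.
  by rewrite !mulr1 mulrC.
split.
- rewrite {1}fE {1}ng {1}dg -!mul_polyC !tofracM.
  by rewrite -!mulf_div !divff ?tofrac_eq0 ?polyC_eq0 // mulr1 mul1r.
- by rewrite monicE lead_coefZ mulVf // lead_coef_eq0.
- rewrite coprimepZl // coprimepZr //; apply: coprimep_div_gcd.
  by rewrite d0 orbT.
Qed.

Lemma dilate_eq0 (K : fieldType) (c : K) (p : {poly K}) :
  c != 0 -> (dilate c p == 0) = (p == 0).
Proof.
move=> c0; apply/idP/idP => [|/eqP->]; last by rewrite /dilate comp_poly0.
move=> /eqP H; apply/eqP/polyP => i; move/polyP/(_ i): H.
have -> : (dilate c p)`_i = p`_i * c ^+ i.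
  rewrite /dilate comp_polyE coef_sum.
  under eq_bigr => j _ do rewrite coefZ exprZn coefZ coefXn.
  case: (ltnP i (size p)) => [lt|ge].
    rewrite (bigD1 (Ordinal lt)) //= eqxx mulr1 big1 ?addr0 // => j /negbTE.
    by rewrite -val_eqE /= eq_sym => ->; rewrite !mulr0.
  rewrite nth_default // mul0r big1 // => j _.
  by rewrite gtn_eqF ?mulr0 // (leq_trans (ltn_ord j)).
by rewrite coef0 => /eqP; rewrite mulf_eq0 expf_eq0 (negbTE c0) andbF orbF => /eqP.
Qed.

Lemma eps_frac (K : fieldType) (q : K) (n d : {poly K}) : q != 0 -> d != 0 ->
  eps q (n%:F / d%:F) = (dilate q n)%:F / (dilate q d)%:F.
Proof.
move=> q0 d0; rewrite /eps; set f := n%:F / d%:F.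
have [fE dm _] := ratfunP f; have e0 := monic_neq0 dm.
apply/eqP; rewrite eqr_div ?tofrac_eq0 ?dilate_eq0 //.
rewrite -!tofracM tofrac_eq /dilate -!comp_polyM.
suff -> : numer f * d = n * denom f by [].
apply/eqP; rewrite -tofrac_eq !tofracM -eqr_div ?tofrac_eq0 //.
by rewrite -fE.
Qed.

Lemma eps_zmod_morphism (K : fieldType) (q : K) :
  q != 0 -> zmod_morphism (eps q).
Proof.
move=> q0 f g; have [fE fm _] := ratfunP f; have [gE gm _] := ratfunP g.
have f0 := monic_neq0 fm; have g0 := monic_neq0 gm.
rewrite {1}fE {1}gE -mulNr addf_div ?tofrac_eq0 //.
rewrite -tofracN -!tofracM -tofracD eps_frac ?mulf_neq0 // /eps.
rewrite -mulNr addf_div ?tofrac_eq0 ?dilate_eq0 //.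
rewrite -tofracN -!tofracM -tofracD /dilate !comp_polyM comp_polyD.
by rewrite !comp_polyM (raddfN (comp_poly _)).
Qed.

Lemma eps_monoid_morphism (K : fieldType) (q : K) :
  q != 0 -> monoid_morphism (eps q).
Proof.
move=> q0; split=> [|f g].
  rewrite -[1 in LHS]divr1 -tofrac1 eps_frac ?oner_eq0 //.
  by rewrite /dilate rmorph1 divr1.
have [fE fm _] := ratfunP f; have [gE gm _] := ratfunP g.
have f0 := monic_neq0 fm; have g0 := monic_neq0 gm.
rewrite {1}fE {1}gE mulf_div -!tofracM eps_frac ?mulf_neq0 // /eps mulf_div.
by rewrite /dilate !comp_polyM !tofracM.
Qed.

Lemma epsC (K : fieldType) (q c : K) : q != 0 -> eps q c%:P%:F = c%:P%:F.
Proof.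
move=> q0; rewrite -[c%:P%:F in LHS]divr1 -tofrac1 eps_frac ?oner_eq0 //.
by rewrite /dilate comp_polyC rmorph1 divr1.
Qed.

Lemma epsX (K : fieldType) (q : K) : q != 0 -> eps q 'X%:F = q%:P%:F * 'X%:F.
Proof.
move=> q0; rewrite -['X%:F in LHS]divr1 -tofrac1 eps_frac ?oner_eq0 //.
by rewrite /dilate comp_polyX rmorph1 divr1 -mul_polyC tofracM.
Qed.

Lemma mgcd_eqp (K : fieldType) (f g : {poly K}) : mgcd f g %= gcdp f g.
Proof.
rewrite /mgcd; have [->|g0] := eqVneq (gcdp f g) 0; first by rewrite scaler0 eqpxx.
by apply: eqp_scale; rewrite invr_eq0 lead_coef_eq0.
Qed.

Lemma pump_loop_total (K : fieldType) (f g : {poly K}) : g != 0 ->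
  exists f' g', [/\ pump_loop f g (f', g'), f' * g' = f * g & coprimep f' g'].
Proof.
have [n] := ubnP (size g); elim: n f g => // n IH f g; rewrite ltnS => sg g0.
have dg : mgcd f g %| g by rewrite (eqp_dvdl _ (mgcd_eqp f g)) dvdp_gcdr.
have d0 : mgcd f g != 0 by apply: contraNneq g0 => E; move: dg; rewrite E dvd0p.
have gE : (g %/ mgcd f g) * mgcd f g = g by rewrite divpK.
have q0 : g %/ mgcd f g != 0 by apply: contraNneq g0 => E; rewrite -gE E mul0r.
have prodE : (f * mgcd f g) * (g %/ mgcd f g) = f * g.
  by rewrite -mulrA [mgcd f g * _]mulrC gE.
have [s1|s1] := eqVneq (size (mgcd f g)) 1%N.
  exists (f * mgcd f g), (g %/ mgcd f g); split=> //; first exact: PumpStop.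
  have cop : coprimep f g by rewrite /coprimep -(eqp_size (mgcd_eqp f g)) s1.
  have /size_poly1P[c c0 cE] : size (mgcd f g) == 1%N by rewrite s1.
  have -> : f * mgcd f g = c *: f by rewrite cE mulrC mul_polyC.
  rewrite coprimepZl //.
  by apply: coprimep_dvdl cop; rewrite divp_dvd.
have lt : (size (g %/ mgcd f g)%R < n)%N.
  apply: leq_trans sg; rewrite size_divp // ltn_subrL.
  rewrite size_poly_gt0 g0 andbT -subn1 subn_gt0.
  by rewrite ltn_neqAle eq_sym s1 size_poly_gt0.
have [f' [g' [H1 H2 H3]]] := IH (f * mgcd f g) (g %/ mgcd f g) lt q0.
exists f', g'; split=> //; last by rewrite H2.
by apply: PumpNext => //; apply/eqP.
Qed.

Lemma algorithm_output_total (K : fieldType) (q : K) (D U : ratfun K)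
    (n0 : nat) : exists U1 F V, algorithm_output q D U n0 U1 F V.
Proof.
rewrite /algorithm_output; set N := qdis _ _ _.
suff H h X1 X2 : exists Y1 Y2 y2,
    for_loop q D h (X1, X2, denom X2) (Y1, Y2, y2).
  have [Y1 [Y2 [y2 Hl]]] := H N 0 U.
  by do 3!eexists; exists Y2, y2; split; [exact: Hl | split].
have stop k Z1 Z2 : k < 1 -> exists Y1 Y2 y2,
    for_loop q D k (Z1, Z2, denom Z2) (Y1, Y2, y2).
  by move=> k1; exists Z1, Z2, (denom Z2); apply: ForStop.
case: h => [h|h]; last exact: stop.
elim: h X1 X2 => [|h IH] X1 X2; first exact: stop.
have [XE xm _] := ratfunP X2; set x2 := denom X2 in XE xm *.
have x0 : x2 != 0 := monic_neq0 xm.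
set v2 := x2 %/ mgcd x2 (denom D).
set s := mgcd v2 (dilate (q ^ (- h.+1%:Z)) v2).
have sx : s %| x2.
  rewrite (eqp_dvdl _ (mgcd_eqp _ _)); apply: dvdp_trans (dvdp_gcdl _ _) _.
  apply: divp_dvd; rewrite (eqp_dvdl _ (mgcd_eqp _ _)); exact: dvdp_gcdl.
have xs0 : x2 %/ s != 0.
  by apply: contraNneq x0 => E; rewrite -(divpK sx) E mul0r.
have [s' [u' [Hp Hm Hc]]] := pump_loop_total s xs0.
have su : s' * u' = x2 by rewrite Hm mulrC divpK.
have /andP[s'0 u'0] : (s' != 0) && (u' != 0).
  by rewrite -negb_or -mulf_eq0 su.
have [[b a] /= ba1] : exists w, w.1 * u' + w.2 * s' = 1.
  have /Bezout_eq1_coprimepP[w Hw] : coprimep u' s' by rewrite coprimep_sym.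
  by exists w.
set b' := numer X2 * b; set a' := numer X2 * a.
pose Z := - (b'%:F / s'%:F) : ratfun K.
have [Y1 [Y2 [y2 Hl]]] := IH (X1 + Z) (X2 - D * eps q Z + Z).
exists Y1, Y2, y2; apply: (@ForNext _ _ _ _ _ (X1 + Z, X2 - D * eps q Z + Z,
  denom (X2 - D * eps q Z + Z))) => //; last first.
  by have -> : h.+1%:Z - 1 = h by rewrite -addn1 PoszD addrK.
exists s', u', a', b'; split=> //.
rewrite addf_div ?tofrac_eq0 // -!tofracM -tofracD [u' * s']mulrC su XE.
congr (_%:F / _); rewrite /a' /b' -!mulrA -mulrDr [a * _ + _]addrC ba1.
by rewrite mulr1.
Qed.

(* Main.v *)
(* Write [v2 = u2 / gcd(u2, d2)] for the part of the denominator of [U2] that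
   the final step does not absorb into [F].  For an irreducible [p] other than
   [x], put the indices [i] with [p(q^i x) | v2] on a line: at the start of the
   iteration with counter [h] no two of them are more than [h] apart.  The
   factors whose index has another one exactly [h] to its right are those of
   [s].  Replacing [b / s~] by [D eps(b / s~)] deletes these indices and moves
   them one to the right; all other new factors divide [d2] and so do not enter
   [v2].  Hence no two indices are [h] apart any more, and after the loop [v2]
   is eps-free.  The evaluation claims hold because every step only introduces
   poles of [U2], [D] and their shifts by [q], and because [F = D w / eps w] and
   [V = U2 w / w(q^n0)] make the product over [F] telescope. *)
Require Import Defs.
From mathcomp Require Import all_boot all_order all_algebra fraction.
From mathcomp Require Import boolp classical_sets ring zify.
Set Implicit Arguments.
Unset Strict Implicit.
Unset Printing Implicit Defensive.
Import Order.TTheory GRing.Theory Num.Theory.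
Local Open Scope ring_scope.

(** * Dilations of polynomials and monic gcds *)

Section Dilation.
Variable K : fieldType.
Implicit Types (c : K) (p f g v : {poly K}).

Lemma dilateM c p f : dilate c (p * f) = dilate c p * dilate c f.
Proof. exact: comp_polyM. Qed.

Lemma dilate_dilate a c p : dilate a (dilate c p) = dilate (a * c) p.
Proof. by rewrite /dilate -comp_polyA comp_polyZ comp_polyX scalerA mulrC. Qed.

Lemma dilate1 p : dilate 1 p = p.
Proof. by rewrite /dilate scale1r comp_polyXr. Qed.

Lemma dilateK c : c != 0 -> cancel (dilate c) (dilate c^-1).
Proof. by move=> c0 p; rewrite dilate_dilate mulVf // dilate1. Qed.

Lemma dilateVK c : c != 0 -> cancel (dilate c^-1) (dilate c).
Proof. by move=> c0 p; rewrite dilate_dilate divff // dilate1. Qed.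

Lemma horner_dilate c p a : (dilate c p).[a] = p.[c * a].
Proof. by rewrite /dilate horner_comp hornerZ hornerX. Qed.

Lemma size_dilate c p : c != 0 -> size (dilate c p) = size p.
Proof. by move=> c0; rewrite /dilate size_comp_poly2 // size_scale // size_polyX. Qed.

Lemma lead_coef_dilate c p :
  c != 0 -> lead_coef (dilate c p) = lead_coef p * c ^+ (size p).-1.
Proof.
move=> c0; rewrite /dilate lead_coef_comp ?size_scale ?size_polyX //.
by rewrite lead_coefZ lead_coefX mulr1.
Qed.

Lemma dvdp_dilate c p f : c != 0 -> (dilate c p %| dilate c f) = (p %| f).
Proof.
move=> c0; apply/idP/idP; last exact: dvdp_comp_poly.
by move=> /(dvdp_comp_poly (c^-1 *: 'X)); rewrite -!/(dilate _ _) !dilateK.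
Qed.

Lemma dvdp_dilater c p f : c != 0 -> (p %| dilate c f) = (dilate c^-1 p %| f).
Proof. by move=> c0; rewrite -{1}[p](dilateVK c0) dvdp_dilate. Qed.

Lemma irreducible_dilate c p :
  c != 0 -> irreducible_poly p -> irreducible_poly (dilate c p).
Proof.
move=> c0 [sp irr]; split=> [|d sd]; first by rewrite size_dilate.
have ci0 : c^-1 != 0 by rewrite invr_eq0.
rewrite -{1}[d](dilateVK c0) dvdp_dilate // => /irr.
rewrite size_dilate // => /(_ sd); rewrite /eqp -(dvdp_dilate (dilate _ d) p c0).
by rewrite -(dvdp_dilate p (dilate _ d) c0) dilateVK.
Qed.

Lemma dilate_eqpX c p : c != 0 -> (dilate c p %= 'X) = (p %= 'X).
Proof.
move=> c0; have eX : dilate c 'X %= 'X.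
  by rewrite /dilate comp_polyX; apply: eqp_scale.
by rewrite -(eqp_rtrans eX) /eqp !dvdp_dilate.
Qed.

Lemma irreducible_dvdM p f g : irreducible_poly p ->
  (p %| f * g) = (p %| f) || (p %| g).
Proof.
move=> irr; apply/idP/orP; last first.
  by case=> [/dvdp_mulr|/dvdp_mull]; apply.
case: (boolP (p %| f)) => [|nf]; [by left|right].
by rewrite -(@Gauss_dvdpr _ g f p) // irreducible_poly_coprime.
Qed.

Lemma divp_neq0 f g : f != 0 -> g %| f -> f %/ g != 0.
Proof. by move=> f0 gf; apply: contraNneq f0 => E; rewrite -(divpK gf) E mul0r. Qed.

Lemma size_divp_lt f g : f != 0 -> (1 < size g)%N -> (size (f %/ g)%R < size f)%N.
Proof.
move=> f0 sg; rewrite size_divp -?size_poly_gt0 ?(ltnW sg) // ltn_subrL.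
by rewrite size_poly_gt0 f0 andbT -subn1 subn_gt0.
Qed.

Lemma mgcd_neq0 f g : g != 0 -> mgcd f g != 0.
Proof.
by move=> g0; rewrite -dvd0p (eqp_dvdr _ (mgcd_eqp f g)) dvd0p gcdp_eq0 (negbTE g0) andbF.
Qed.

Lemma dvdp_mgcd p f g : (p %| mgcd f g) = (p %| f) && (p %| g).
Proof. by rewrite (eqp_dvdr _ (mgcd_eqp f g)) dvdp_gcd. Qed.

Lemma mgcd_dvdl f g : mgcd f g %| f.
Proof. by rewrite (eqp_dvdl _ (mgcd_eqp f g)) dvdp_gcdl. Qed.

Lemma mgcd_dvdr f g : mgcd f g %| g.
Proof. by rewrite (eqp_dvdl _ (mgcd_eqp f g)) dvdp_gcdr. Qed.

Lemma mgcd_eq1 f g : (mgcd f g == 1) = coprimep f g.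
Proof.
apply/eqP/idP => [E|cop]; first by rewrite /coprimep -(eqp_size (mgcd_eqp f g)) E size_poly1.
move: cop; rewrite /mgcd /coprimep => /size_poly1P[c c0 ->].
by rewrite lead_coefC -mul_polyC -polyCM mulVf.
Qed.

Lemma mgcdC f g : g != 0 -> mgcd f g = mgcd g f.
Proof.
move=> g0; have gm a b : gcdp a b != 0 -> mgcd a b \is monic.
  by move=> n0; rewrite monicE lead_coefZ mulVf // lead_coef_eq0.
apply/eqP; rewrite -eqp_monic ?gm ?gcdp_eq0 ?(negbTE g0) ?andbF //.
apply: eqp_trans (mgcd_eqp f g) (eqp_trans (gcdpC f g) _).
by rewrite eqp_sym mgcd_eqp.
Qed.

Lemma coprimep_div_mgcd f g : g != 0 ->
  coprimep (f %/ mgcd f g) (g %/ mgcd f g).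
Proof.
move=> g0; have m0 := mgcd_neq0 f g0.
have := @coprimep_div_gcd _ f g; rewrite g0 orbT => /(_ isT).
have d0 : gcdp f g != 0 by rewrite gcdp_eq0 negb_and g0 orbT.
rewrite /mgcd divpZr ?invr_eq0 ?lead_coef_eq0 // divpZr ?invr_eq0 ?lead_coef_eq0 //.
by rewrite invrK coprimepZl ?coprimepZr ?lead_coef_eq0.
Qed.

(** Cancelling the gcd leaves coprime cofactors. Divisibilities by [residual] are later settled in
    this quotient-free form. *)
Lemma div_mgcd_dvd f g p : g != 0 -> (f %/ mgcd f g %| p) = (f %| p * g).
Proof.
move=> g0; have m0 := mgcd_neq0 f g0.
rewrite -[X in _ = (X %| _)](divpK (mgcd_dvdl f g)).
rewrite -[X in _ = (_ %| _ * X)](divpK (mgcd_dvdr f g)).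
by rewrite mulrA dvdp_mul2r // Gauss_dvdpl // coprimep_div_mgcd.
Qed.

End Dilation.

(** * Finiteness of the dispersion set *)

Section Dispersion.
Variables (K : fieldType) (q : K).
Implicit Types (p u v : {poly K}).
Hypothesis q_neq0 : q != 0.
Hypothesis q_not_root1 : forall k : nat, (0 < k)%N -> q ^+ k != 1.

(** Sizes agree, so divisibility would make [p] and [p(q^k x)] associates. As [p(0)] is nonzero,
    constant terms force equality, and leading coefficients then give [q^(k deg p) = 1]. *)
Lemma irreducible_ndvd_dilate p k : irreducible_poly p -> ~~ (p %= 'X) ->
  (0 < k)%N -> ~~ (p %| dilate (q ^+ k) p).
Proof.
move=> irr pX k0; have qk0 : q ^+ k != 0 by rewrite expf_neq0.
apply/negP => dv; have sz : size p == size (dilate (q ^+ k) p) by rewrite size_dilate.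
move: sz; rewrite (dvdp_size_eqp dv) => /eqpP[[c1 c2] /andP[/= c10 c20] E].
have p00 : p.[0] != 0.
  apply: contraNN pX => p0; have /factor_theorem[r Er] : root p 0 := p0.
  rewrite subr0 in Er.
  by rewrite eqp_sym; apply: irr.2; rewrite ?size_polyX // Er dvdp_mull.
have cE : c1 = c2.
  move/(congr1 (horner^~ 0)): E; rewrite !hornerZ horner_dilate mulr0.
  exact: mulIf.
have l0 : lead_coef p != 0 by rewrite lead_coef_eq0 irredp_neq0.
move/(congr1 lead_coef): E; rewrite !lead_coefZ lead_coef_dilate // cE.
move/(mulfI c20); rewrite -{1}[lead_coef p]mulr1 => /(mulfI l0)/esym/eqP.
rewrite -exprM; apply/negP/q_not_root1; rewrite muln_gt0 k0 -subn1 subn_gt0.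
exact: irr.1.
Qed.

(** If some [k0] occurs, split [r = p(q^-k0 x)] off [v] and induct on the size. For [k > k0], [p]
    does not divide [r(q^k x) = p(q^(k - k0) x)], so it divides the dilated cofactor. *)
Lemma dvdp_dilate_bounded p v : irreducible_poly p -> ~~ (p %= 'X) -> v != 0 ->
  exists B, forall k, p %| dilate (q ^+ k) v -> (k <= B)%N.
Proof.
move=> irr pX; have [n] := ubnP (size v); elim: n v => // n IH v.
rewrite ltnS => sv v0.
have [[k0 dk0]|nex] := pselect (exists k, p %| dilate (q ^+ k) v); last first.
  by exists 0%N => k dk; case: nex; exists k.
have qk0 k : q ^+ k != 0 by rewrite expf_neq0.
set r := dilate (q ^+ k0)^-1 p.
have rv : r %| v by rewrite -(dvdp_dilate _ _ (qk0 k0)) dilateVK.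
have vE := divpK rv.
have /andP[w0 r0] : (v %/ r != 0) && (r != 0) by rewrite -negb_or -mulf_eq0 vE.
have [|//|B HB] := IH (v %/ r).
  by apply: leq_trans sv; rewrite size_divp_lt // size_dilate ?invr_eq0 // irr.1.
exists (maxn k0 B) => k; have [le|gt] := leqP k k0; first by rewrite leq_max le.
rewrite -vE dilateM irreducible_dvdM // => /orP[/HB|]; first by rewrite leq_max orbC => ->.
rewrite /r dilate_dilate -(subnK (ltnW gt)) exprD mulfK //.
by rewrite (negbTE (irreducible_ndvd_dilate irr pX _)) // subn_gt0.
Qed.

(** Peel the irreducible factors other than [x] off [u]; each contributes a bounded set of
    shifts. *)
Lemma qdis_set_bounded u v : u != 0 -> v != 0 ->
  exists B, forall k, qdis_set q u v k -> (k <= B)%N.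
Proof.
move=> + v0; have [n] := ubnP (size u); elim: n u => // n IH u.
rewrite ltnS => su u0.
have [[p [irr pX pu]]|nex] :=
    pselect (exists p, [/\ irreducible_poly p, ~~ (p %= 'X) & p %| u]); last first.
  by exists 0%N => k [p [irr pX pu _]]; case: nex; exists p.
have uE := divpK pu.
have /andP[w0 p0] : (u %/ p != 0) && (p != 0) by rewrite -negb_or -mulf_eq0 uE.
have [||B HB] := IH (u %/ p) => //.
  by apply: leq_trans su; rewrite size_divp_lt // irr.1.
have [B' HB'] := dvdp_dilate_bounded irr pX v0.
exists (maxn B B') => k [r [irr' rX]]; rewrite -uE irreducible_dvdM //.
case/orP=> [ru rv|rp rv]; first by rewrite leq_max HB //; exists r.
have sr : size r != 1%N by rewrite neq_ltn irr'.1 orbT.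
by rewrite leq_max orbC HB' // -(eqp_dvdl _ (irr.2 _ sr rp)).
Qed.

(** An inhabited set is bounded and so has a maximum; the default [-1] of [qdis] cannot hide an
    element. *)
Lemma qdis_lt u v k : u != 0 -> v != 0 -> qdis q u v < k%:Z ->
  ~ qdis_set q u v k.
Proof.
move=> u0 v0 + Sk; rewrite /qdis; set P := (X in xget _ X).
suff : exists m, P m.
  by case/(xgetPex (-1)) => h [-> _ /(_ _ Sk) le]; rewrite ltz_nat ltnNge le.
have [B HB] := qdis_set_bounded u0 v0.
have exS : exists i, `[< qdis_set q u v i >] by exists k; apply/asboolP.
have ubS i : `[< qdis_set q u v i >] -> (i <= B)%N by move/asboolP/HB.
case: (ex_maxnP exS ubS) => m /asboolP Sm max; exists m%:Z, m; split=> // h Sh.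
exact/max/asboolP.
Qed.

Lemma eps_free_of_disjoint v :
  (forall k, (0 < k)%N -> ~ qdis_set q v v k) -> eps_free q v.
Proof.
move=> H; rewrite /eps_free /qdis; case: xgetP => [m -> [h [-> Sh _]]|//].
by case: h Sh => // h /H; case.
Qed.

End Dispersion.

(** * Values of rational functions *)

Section Evaluation.
Variable K : fieldType.
Implicit Types (f g : ratfun K) (n d : {poly K}) (c x y : K).

Lemma numer_eq0 f : (numer f == 0) = (f == 0).
Proof.
have [fE dm _] := ratfunP f; rewrite [f in RHS]fE.
by rewrite mulf_eq0 invr_eq0 !tofrac_eq0 (negbTE (monic_neq0 dm)) orbF.
Qed.

Lemma numer_denom_frac n d : d != 0 ->
  numer (n%:F / d%:F) * d = n * denom (n%:F / d%:F).
Proof.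
move=> d0; set f := n%:F / d%:F; have [fE dm _] := ratfunP f.
have e0 := monic_neq0 dm.
apply/eqP; rewrite -tofrac_eq !tofracM -eqr_div ?tofrac_eq0 //.
by rewrite -fE.
Qed.

Lemma denom_frac_dvd n d : d != 0 -> denom (n%:F / d%:F) %| d.
Proof.
move=> d0; have [_ _ cop] := ratfunP (n%:F / d%:F).
rewrite -(@Gauss_dvdpr _ _ (numer (n%:F / d%:F))) 1?coprimep_sym //.
by rewrite numer_denom_frac // dvdp_mull.
Qed.

Lemma numer_frac_dvd n d : d != 0 -> numer (n%:F / d%:F) %| n.
Proof.
move=> d0; have [_ _ cop] := ratfunP (n%:F / d%:F).
rewrite -(@Gauss_dvdpl _ _ (denom (n%:F / d%:F))) //.
by rewrite -numer_denom_frac // dvdp_mulr.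
Qed.

Lemma horner_neq0 (d : {poly K}) c : d.[c] != 0 -> d != 0.
Proof. by apply: contraNneq => ->; rewrite horner0. Qed.

(** Any fraction without a pole at [c] may serve, reduced or not, so sums, products and shifts of
    witnesses need no cancellation. *)
Definition evals_to f c x := exists n d,
  [/\ d.[c] != 0, f = n%:F / d%:F & x = n.[c] / d.[c]].

(** The reduced denominator divides every other one, hence does not vanish at [c];
    cross-multiplication identifies the values. *)
Lemma evals_toP f c x :
  evals_to f c x <-> defined_at f c /\ value_at f c = x.
Proof.
split=> [[n [d [dc -> ->]]]|[df <-]]; last first.
  by have [fE _ _] := ratfunP f; exists (numer f), (denom f).
have d0 := horner_neq0 dc.
have ec : defined_at (n%:F / d%:F) c.
  by apply: contraNneq dc => e0; rewrite -(divpK (denom_frac_dvd n d0)) hornerM e0 mulr0.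
split=> //; rewrite /value_at; apply/eqP; rewrite eqr_div //.
by rewrite -!hornerM numer_denom_frac.
Qed.

Lemma evals_to_value f c : defined_at f c -> evals_to f c (value_at f c).
Proof. by move=> df; apply/evals_toP. Qed.

Lemma evals_to_frac n d c : d.[c] != 0 -> evals_to (n%:F / d%:F) c (n.[c] / d.[c]).
Proof. by move=> dc; exists n, d. Qed.

Lemma evals_to_poly n c : evals_to n%:F c n.[c].
Proof. by exists n, 1; rewrite tofrac1 !divr1 hornerC divr1 oner_eq0. Qed.

Lemma evals_to0 c : evals_to 0 c 0.
Proof. by have := evals_to_poly 0 c; rewrite tofrac0 hornerC. Qed.

Lemma evals_toD f g c x y :
  evals_to f c x -> evals_to g c y -> evals_to (f + g) c (x + y).
Proof.
move=> [n [d [dc -> ->]]] [m [e [ec -> ->]]].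
have d0 := horner_neq0 dc.
have e0 := horner_neq0 ec.
exists (n * e + m * d), (d * e); rewrite hornerM mulf_neq0 //; split=> //.
  by rewrite addf_div ?tofrac_eq0 // tofracD !tofracM.
by rewrite addf_div // hornerD !hornerM.
Qed.

Lemma evals_toM f g c x y :
  evals_to f c x -> evals_to g c y -> evals_to (f * g) c (x * y).
Proof.
move=> [n [d [dc -> ->]]] [m [e [ec -> ->]]].
exists (n * m), (d * e); rewrite hornerM mulf_neq0 //; split=> //.
  by rewrite mulf_div !tofracM.
by rewrite mulf_div hornerM.
Qed.

Lemma evals_toN f c x : evals_to f c x -> evals_to (- f) c (- x).
Proof.
move=> [n [d [dc -> ->]]]; exists (- n), d; split=> //.
  by rewrite tofracN mulNr.
by rewrite hornerN mulNr.
Qed.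

Lemma evals_toV f c x : x != 0 -> evals_to f c x -> evals_to f^-1 c x^-1.
Proof.
move=> x0 [n [d [dc -> xE]]]; move: x0; rewrite xE.
rewrite mulf_eq0 invr_eq0 (negbTE dc) orbF => nc.
by exists d, n; split; rewrite ?invf_div.
Qed.

Lemma evals_to_eps q f c x : q != 0 ->
  evals_to f (q * c) x -> evals_to (eps q f) c x.
Proof.
move=> q0 [n [d [dc -> ->]]].
have d0 := horner_neq0 dc.
by rewrite eps_frac //; exists (dilate q n), (dilate q d); rewrite !horner_dilate.
Qed.

End Evaluation.

(** * From multiplicative representations to q-hypergeometric terms *)

Section Terms.
Variables (K : fieldType) (q : K).
Hypothesis q_neq0 : q != 0.
Hypothesis q_not_root1 : forall k : nat, (0 < k)%N -> q ^+ k != 1.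

Lemma expf_inj : injective (fun n => q ^+ n).
Proof.
move=> m n; wlog le : m n / (m <= n)%N => [H E|].
  by have [/H->|/ltnW/H H'] := leqP m n => //; rewrite (H' (esym E)).
rewrite /= -{1}(subnK le) exprD => /eqP; rewrite -{1}[q ^+ m]mul1r.
rewrite (inj_eq (mulIf (expf_neq0 _ q_neq0))) => /eqP E.
have [|lt] := leqP n m; first by move=> ge; apply/eqP; rewrite eqn_leq le.
by move: (lt); rewrite -subn_gt0 => /q_not_root1; rewrite -E eqxx.
Qed.

(** Each root [q^k] splits off a linear factor, which vanishes at no later power because the powers
    of [q] are distinct. *)
Lemma eventually_nonroot (p : {poly K}) : p != 0 ->
  exists N, forall n, (N <= n)%N -> p.[q ^+ n] != 0.
Proof.
have [m] := ubnP (size p); elim: m p => // m IH p; rewrite ltnS => sp p0.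
have [[k pk]|nex] := pselect (exists k, p.[q ^+ k] = 0); last first.
  by exists 0%N => n _; apply/eqP => pn; apply: nex; exists n.
have /factor_theorem[r rE] : root p (q ^+ k) by apply/rootP.
have r0 : r != 0 by apply: contraNneq p0 => r0; rewrite rE r0 mul0r.
have [||N HN] := IH r => //.
  by apply: leq_trans sp; rewrite rE size_Mmonic ?monicXsubC // size_XsubC addn2.
exists (maxn N k.+1) => n; rewrite geq_max => /andP[/HN rn kn].
rewrite rE hornerM mulf_neq0 // !hornerE subr_eq0.
by apply: contraTneq kn => /expf_inj ->; rewrite ltnn.
Qed.

Lemma q_mult_repr_hypergeometric T (D U : ratfun K) n0 :
  q_mult_repr q T D U n0 -> q_hypergeometric q T.
Proof.
(* [R] must be nonzero. If [U = 0], the term vanishes from [n0] on and [R = 1] serves; otherwise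
   [R = D eps(U) / U], used past the zeros of [U]. *)
move=> rep; have [U0|U0] := eqVneq U 0.
  rewrite U0 in rep; exists n0; exists 1; first exact: oner_neq0.
  move=> n le; have e1 : evals_to (1 : ratfun K) (q ^+ n) 1.
    by have := evals_to_poly 1 (q ^+ n); rewrite tofrac1 hornerC.
  have /evals_toP[d1 ->] := e1; split=> //.
  have T0 k : (n0 <= k)%N -> T k = 0.
    by move=> /rep[_ _ _ ->]; have /evals_toP[_ ->] := evals_to0 (q ^+ k); rewrite mul0r.
  by rewrite !T0 ?mulr0 // leqW.
have [_ um _] := ratfunP U.
have nu0 : numer U != 0 by rewrite numer_eq0.
have [N HN] := eventually_nonroot nu0.
exists (maxn n0 N); exists (D * eps q U / U).
  have [d0 v0 _ _] := rep _ (leqnn n0).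
  have D0 : D != 0.
    apply: contraNneq v0 => D0; rewrite D0 in d0 *.
    have E : numer (0 : ratfun K) = 0 by apply/eqP; rewrite numer_eq0.
    by rewrite /value_at E horner0 mul0r.
  have e0 : eps q U != 0.
    rewrite /eps; apply: mulf_neq0; rewrite ?invr_eq0 tofrac_eq0 dilate_eq0 //.
    exact: monic_neq0.
  exact: (mulf_neq0 (mulf_neq0 D0 e0) (invr_neq0 U0)).
move=> n; rewrite geq_max => /andP[le /HN nun].
have [dD vD dU TE] := rep _ le; have [_ _ dU' TE'] := rep _ (leqW le).
have vU : value_at U (q ^+ n) != 0 by rewrite mulf_neq0 // invr_eq0.
have /evals_toP[? ->] : evals_to (D * eps q U / U) (q ^+ n)
    (value_at D (q ^+ n) * value_at U (q ^+ n.+1) / value_at U (q ^+ n)).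
  apply: evals_toM; last by apply: evals_toV => //; apply: evals_to_value.
  apply: evals_toM; first exact: evals_to_value.
  by apply: evals_to_eps => //; rewrite -exprS; apply: evals_to_value.
split=> //; rewrite TE TE' big_nat_recr //=; field.
exact: vU.
Qed.

End Terms.

(** * Pumping, and separation along dilation orbits *)

(** Each round moves a common factor from [g] to [f], which keeps the product and gives [f] no new
    irreducible factor. *)
Lemma pump_loop_spec (K : fieldType) (f g : {poly K}) r :
  pump_loop f g r -> g != 0 ->
  [/\ r.1 * r.2 = f * g, coprimep r.1 r.2, f %| r.1
    & forall p, irreducible_poly p -> p %| r.1 -> p %| f].
Proof.
move=> H; elim: H => {f g r} [f g d sd|f g r d sd _ IH] g0.
  have dg : d %| g := mgcd_dvdr f g.
  split=> /=; first by rewrite -mulrA [d * _]mulrC divpK.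
  - have cop : coprimep f g by rewrite /coprimep -(eqp_size (mgcd_eqp f g)) -/d sd.
    (* The last gcd is monic, so the final multiplication and division change nothing. *)
    have d1 : d = 1 by apply/eqP; rewrite mgcd_eq1.
    by rewrite d1 mulr1 divp1.
  - exact: dvdp_mulr.
  - move=> p irr; rewrite irreducible_dvdM // => /orP[//|pd].
    exact: dvdp_trans pd (mgcd_dvdl f g).
have dg : d %| g := mgcd_dvdr f g.
have gE := divpK dg.
have [E cop dv irrf] := IH (divp_neq0 g0 dg).
split=> //; first by rewrite E -mulrA [d * _]mulrC gE.
  exact: dvdp_trans (dvdp_mulr _ (dvdpp f)) dv.
move=> p irr /(irrf _ irr); rewrite irreducible_dvdM // => /orP[//|pd].
exact: dvdp_trans pd (mgcd_dvdl f g).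
Qed.

Section Separation.
Variables (K : fieldType) (q : K).
Hypothesis q_neq0 : q != 0.
Implicit Types (p v s : {poly K}).

(** This negates [qdis_set q v v k] with the dilation moved from [v] to [p], so that both indices on
    the orbit concern divisors of the same polynomial. *)
Definition separated v k := forall p, irreducible_poly p -> ~~ (p %= 'X) ->
  p %| v -> ~~ (dilate (q ^+ k) p %| v).

Lemma separatedP v k : separated v k <-> ~ qdis_set q v v k.
Proof.
have qk : q ^+ k != 0 by rewrite expf_neq0.
split=> [sep [p [irr pX pv]]|nS p irr pX pv]; last first.
  apply/negP => pkv; apply: nS; exists (dilate (q ^+ k) p).
  by rewrite dilate_eqpX // dvdp_dilate //; split=> //; apply: irreducible_dilate.
rewrite -{1}[p](dilateVK qk) dvdp_dilate // => /sep.
rewrite dilateVK // pv => H; apply: (elimN idP (H _ _)) => //.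
  by apply: irreducible_dilate; rewrite ?invr_eq0.
by rewrite dilate_eqpX ?invr_eq0.
Qed.

Lemma separated_dvd v v' k : v' %| v -> separated v k -> separated v' k.
Proof.
move=> dv sep p irr pX /dvdp_trans/(_ dv)/(sep p irr pX).
by apply: contra => /dvdp_trans; apply.
Qed.

(* Along the orbit [p(x), p(q x), p(q^2 x), ...] the factors of [v] span at most
   [h] steps; [s] collects the first factors of the spans of length exactly [h],
   and passing to [v'] moves them one step forward. *)
Lemma separated_step v v' s h : (0 < h)%N ->
  (forall p, irreducible_poly p ->
     (p %| s) = (p %| v) && (dilate (q ^+ h) p %| v)) ->
  (forall p, irreducible_poly p -> p %| v' ->
     p %| dilate q s \/ p %| v /\ ~~ (p %| s)) ->
  (forall k, (h < k)%N -> separated v k) ->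
  forall k, (h <= k)%N -> separated v' k.
Proof.
move=> h0 sE v'E sep k hk r irr rX rv'; apply/negP => rkv'.
have qV0 : q^-1 != 0 by rewrite invr_eq0.
have qk0 n : q ^+ n != 0 by rewrite expf_neq0.
have irrV p : irreducible_poly p -> irreducible_poly (dilate q^-1 p).
  exact: irreducible_dilate.
have irrk : irreducible_poly (dilate (q ^+ k) r) by apply: irreducible_dilate.
have dvE p : (p %| dilate q s) = (dilate q^-1 p %| s) by rewrite dvdp_dilater.
have rX' : ~~ (dilate q^-1 r %= 'X) by rewrite dilate_eqpX.
(* Each of [r] and [r(q^k x)] either came from one index to the left or stayed. If [r] moved, [v]
   had index [-1] and also [h + k - 1] or [k], a distance above [h]. *)
case: (v'E _ irr rv') => [|[rv rs]].
  rewrite dvE sE; last exact: irrV.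
  case/andP=> r'v _; case: (v'E _ irrk rkv') => [|[rkv _]].
    rewrite dvE sE; last exact: irrV.
    case/andP=> _; rewrite !dilate_dilate.
    have -> : q ^+ h * q^-1 * q ^+ k = q ^+ (h + k) * q^-1.
      by rewrite exprD mulrAC.
    rewrite -dilate_dilate; apply/negP/sep => //; last exact: irrV.
    by rewrite -[h in X in (X <= _)%N]addn0 -addnS leq_add2l (leq_trans h0).
  move: rkv; have -> : q ^+ k = q ^+ k.+1 * q^-1 by rewrite exprSr mulfK.
  rewrite -dilate_dilate; apply/negP/sep => //; exact: irrV.
(* If only [r(q^k x)] moved, [v] has indices [0] and [h + k - 1]. Their distance fails to exceed [h]
   only for [h = k = 1], and then [r] would divide [s]. *)
case: (v'E _ irrk rkv') => [|[rkv _]].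
  rewrite dvE sE; last exact: irrV.
  case/andP=> _; rewrite !dilate_dilate.
  have -> : q ^+ h * q^-1 * q ^+ k = q ^+ (h.-1 + k).
    by rewrite -{1}(prednK h0) exprSr mulfK // exprD.
  have [lt|] := ltnP h (h.-1 + k); first exact/negP/sep.
  move=> le rkv; have h1 : h = 1%N by lia.
  move: rkv rs; have -> : (h.-1 + k)%N = h by lia.
  by rewrite sE // rv => ->.
(* Both stayed: the distance [k] can only be [h], which again makes [r] divide [s]. *)
have [lt|ge] := ltnP h k; first by move: rkv; apply/negP/sep.
have E : k = h by lia.
by move: rs; rewrite sE // rv -E rkv.
Qed.

End Separation.

(** * The loop invariant *)

Lemma sum_over_lcm (F : fieldType) (a c e g d s : F) :
  e != 0 -> g != 0 -> d != 0 -> s != 0 ->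
  a / (e * g) + c / (d * g * s) = (a * d * s + c * e) / (e * (d * g) * s).
Proof. by move=> e0 g0 d0 s0; field; rewrite e0 g0 d0 s0. Qed.

Lemma transfer_telescoped (R : pzRingType) (B E E' D X Y : R) :
  X - D * E + Y - D * E' + B = X - D * (E + E') + (Y + B).
Proof. by rewrite mulrDr opprD !addrA; congr (_ + _); rewrite addrAC. Qed.

Section EpsMorphism.
Variables (K : fieldType) (q : K).
Hypothesis q_neq0 : q != 0.

Lemma eps0 : eps q 0 = 0.
Proof. by have := eps_zmod_morphism q_neq0 0 0; rewrite !subrr. Qed.

Lemma epsN f : eps q (- f) = - eps q f.
Proof.
rewrite -[- f]sub0r; have -> := eps_zmod_morphism q_neq0 0 f.
by rewrite eps0 sub0r.
Qed.

Lemma epsD f g : eps q (f + g) = eps q f + eps q g.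
Proof.
rewrite -{1}[g]opprK; have -> := eps_zmod_morphism q_neq0 f (- g).
by rewrite epsN opprK.
Qed.

End EpsMorphism.

Section Loop.
Variables (K : fieldType) (q : K).
Hypothesis q_neq0 : q != 0.
Variables (D U : ratfun K) (n0 : nat).
Hypothesis D_defined : forall n, (n0 <= n)%N -> defined_at D (q ^+ n).

(* [v2] of the algorithm *)
Definition residual (u2 : {poly K}) := u2 %/ mgcd u2 (denom D).

(** Times the product of the values of [D], [D eps(U1) - U1] is the forward difference of the term
    of [U1], so [U2] represents what remains of [T]. The last clause records that distances above
    the counter are already gone. *)
Definition loop_invariant (h : int) (st : ratfun K * ratfun K * {poly K}) :=
  let: (U1, U2, u2) := st in
  [/\ u2 = denom U2, U2 = U - D * eps q U1 + U1,
      forall n, (n0 <= n)%N -> defined_at U1 (q ^+ n),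
      forall n, (n0 <= n)%N -> defined_at U2 (q ^+ n)
    & forall k : nat, h < k%:Z -> separated q (residual u2) k].

(** The denominator of the sum divides [(ut2 / g) * d2 * eps(st2)], and [residual] cancels [d2]. *)
Lemma residual_transfer (st2 ut2 a b : {poly K}) p :
  st2 != 0 -> ut2 != 0 -> irreducible_poly p ->
  p %| residual (denom (a%:F / ut2%:F + D * eps q (b%:F / st2%:F))) ->
  p %| dilate q st2 \/ p %| residual ut2.
Proof.
move=> s0 u0 irr; set d2 := denom D; set g := mgcd ut2 d2.
have [DE dm _] := ratfunP D; have d20 : d2 != 0 := monic_neq0 dm.
have uE : ut2 %/ g * g = ut2 by rewrite divpK ?mgcd_dvdl.
have dE : d2 %/ g * g = d2 by rewrite divpK ?mgcd_dvdr.
have /andP[e0 g0] : (ut2 %/ g != 0) && (g != 0) by rewrite -negb_or -mulf_eq0 uE.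
have /andP[d0 _] : (d2 %/ g != 0) && (g != 0) by rewrite -negb_or -mulf_eq0 dE.
have es0 : dilate q st2 != 0 by rewrite dilate_eq0.
(* The common factor [g] of [ut2] and [d2] is counted once; with [ut2 * d2] instead, only [p %| ut2]
   would follow in the second case. *)
set den := ut2 %/ g * d2 * dilate q st2.
have den0 : den != 0 by rewrite !mulf_neq0.
have -> : a%:F / ut2%:F + D * eps q (b%:F / st2%:F)
    = (a * (d2 %/ g) * dilate q st2 + numer D * dilate q b * (ut2 %/ g))%:F
      / den%:F.
  rewrite eps_frac // [D in LHS]DE mulf_div -/d2 /den -[in LHS]uE -[in LHS]dE.
  rewrite -[X in _ = _ / (_ * X * _)%:F]dE !(tofracD, tofracM).
  by apply: sum_over_lcm; rewrite tofrac_eq0.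
set num := _ + _; have := denom_frac_dvd num den0.
move: (denom _) => e dv pv; apply/orP; rewrite orbC -irreducible_dvdM //; apply: dvdp_trans pv _.
by rewrite /residual div_mgcd_dvd // mulrAC.
Qed.

Lemma iteration_invariant h st st' : 1 <= h -> loop_invariant h st ->
  iteration q D h st st' -> loop_invariant (h - 1) st'.
Proof.
case: h => // h h1; case: st => [[U1 U2] u2] [uE U2E dU1 dU2 sep].
case=> st2 [ut2 [a [b [pmp U2ab /= ->]]]]; rewrite -/(residual u2) in pmp.
set v := residual u2 in pmp sep *.
have [_ um _] := ratfunP U2; have u0 : u2 != 0 by rewrite uE monic_neq0.
have [_ dm _] := ratfunP D; have d20 := monic_neq0 dm.
set s := mgcd _ _ in pmp.
have vu : v %| u2 by rewrite div_mgcd_dvd // dvdp_mulr.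
have su : s %| u2 := dvdp_trans (mgcd_dvdl _ _) vu.
have us0 := divp_neq0 u0 su.
have [/= suE cop ss irrs] := pump_loop_spec pmp us0.
rewrite divpKC // in suE.
have /andP[s0 ut0] : (st2 != 0) && (ut2 != 0) by rewrite -negb_or -mulf_eq0 suE.
set B := b%:F / st2%:F in U2ab *.
(* The denominator of [U2] is [st2 * ut2], so [B] has no pole where [U2] has none. *)
have dB n : (n0 <= n)%N -> exists x, evals_to B (q ^+ n) x.
  move=> /dU2; rewrite /defined_at -uE -suE hornerM mulf_eq0 negb_or => /andP[sn _].
  by eexists; apply: evals_to_frac.
split=> //.
- by rewrite {1}U2E epsD // transfer_telescoped.
- move=> n le; have [x ex] := dB _ le.
  by have /evals_toP[] := evals_toD (evals_to_value (dU1 _ le)) (evals_toN ex).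
- move=> n le; have [x ex] := dB _ le; have [y ey] := dB _ (leqW le).
  rewrite exprS in ey.
  have eNB := evals_to_eps q_neq0 (evals_toN ey).
  have eD := evals_to_value (D_defined le).
  have e2 := evals_to_value (dU2 _ le).
  have e := evals_toD (evals_toD e2 (evals_toN (evals_toM eD eNB))) (evals_toN ex).
  by have /evals_toP[] := e.
(* Subtracting [B] cancels the part [b / st2] of [U2] and leaves only its transfer [D eps(B)]. *)
have -> : U2 - D * eps q (- B) - B = a%:F / ut2%:F + D * eps q B.
  by rewrite epsN // mulrN opprK U2ab -/B addrAC addrK.
have qh0 : q ^+ h != 0 by rewrite expf_neq0.
have sE p : (p %| s) = (p %| v) && (dilate (q ^+ h) p %| v).
  by rewrite dvdp_mgcd -exprnN dvdp_dilater ?invr_eq0 // invrK.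
move=> k hk; apply: (@separated_step _ _ q_neq0 v _ s h) => //.
(* Pumping only raises multiplicities, so irreducible factors of [st2] divide [s]. *)
- move=> p irr /(residual_transfer s0 ut0 irr)[ps|pu].
    left; move: ps; rewrite !dvdp_dilater // => ps.
    by apply: irrs ps; apply: irreducible_dilate; rewrite ?invr_eq0.
  (* [ut2] divides [u2], which divides [v * d2]; and [s] divides [st2], which is coprime to
     [ut2]. *)
  right; split.
    apply: dvdp_trans pu _; rewrite div_mgcd_dvd //.
    apply: (@dvdp_trans _ u2); first by rewrite -suE dvdp_mull.
    by rewrite -div_mgcd_dvd.
  apply/negP => ps; have pst := dvdp_trans ps ss.
  have pu' : p %| ut2 by apply: dvdp_trans pu _; rewrite div_mgcd_dvd // dvdp_mulr.
  have := irr.1; have /coprimepP/(_ p pst pu') := cop.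
  by rewrite -size_poly_eq1 => /eqP ->.
- by move: hk; lia.
Qed.

(** The exit counter is [0] unless the loop starts below [1], hence only an upper bound on it. *)
Lemma for_loop_invariant h st st' : loop_invariant h st ->
  for_loop q D h st st' -> exists2 h', h' < 1 & loop_invariant h' st'.
Proof.
move=> + H; elim: H => {h st st'} [h st h1 inv|h st st1 st2 h1 it _ IH inv].
  by exists h.
exact/IH/(iteration_invariant h1 inv it).
Qed.

End Loop.

(** * The final step and the theorem *)

Lemma prod_telescope (K : fieldType) (a w : nat -> K) m n :
  (forall k, (m <= k)%N -> w k != 0) -> (m <= n)%N ->
  \prod_(m <= j < n) (a j * (w j / w j.+1)) = \prod_(m <= j < n) a j * (w m / w n).
Proof.
move=> w0 le; rewrite big_split /=; congr (_ * _); rewrite -(subnKC le).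
elim: (n - m)%N => [|k IH]; first by rewrite addn0 big_geq // divff ?w0.
rewrite addnS big_nat_recr ?leq_addr //= IH mulrA divfK //.
by rewrite w0 // leq_addr.
Qed.

(** Both factors of the new denominator come from divisors of [denom D], one of them dilated by [q];
    the hypothesis on [D] at the shifts [h + 1] and [h] covers them. *)
Lemma eps_reduced_shift (K : fieldType) (q : K) (D : ratfun K) (w : {poly K}) :
  q != 0 -> w %| denom D -> eps_reduced q D ->
  eps_reduced q ((numer D)%:F / (dilate q w * (denom D %/ w))%:F).
Proof.
move=> q0 wd redD h; have [_ dm _] := ratfunP D.
have dE := divpK wd.
have /andP[d0 w0] : (denom D %/ w != 0) && (w != 0).
  by rewrite -negb_or -mulf_eq0 dE monic_neq0.
set f2 := dilate q w * _; have f20 : f2 != 0 by rewrite mulf_neq0 ?dilate_eq0.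
have cop k : coprimep (numer D) (dilate (q ^ k) (denom D)).
  by rewrite -mgcd_eq1 redD.
apply/eqP; rewrite mgcd_eq1.
have dv : dilate (q ^ h) (denom ((numer D)%:F / f2%:F)) %| dilate (q ^ h) f2.
  exact/dvdp_comp_poly/denom_frac_dvd.
apply: coprimep_dvdl dv _.
apply: coprimep_dvdr (numer_frac_dvd (numer D) f20) _.
rewrite dilateM coprimepMr dilate_dilate -[q in _ ^ h * q]expr1z -expfzDr //.
apply/andP; split.
  by apply: coprimep_dvdl (cop (h + 1)); apply: dvdp_comp_poly wd.
apply: coprimep_dvdl (cop h); apply: dvdp_comp_poly.
by rewrite -{2}dE dvdp_mulr.
Qed.

Theorem theorem2p7 (K : fieldType) (char0 : [pchar K] =i pred0)
    (q : K) (q_neq0 : q != 0)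
    (q_not_root1 : forall k : nat, (0 < k)%N -> q ^+ k != 1)
    (T : nat -> K) (T_hyp : q_hypergeometric q T)
    (D U : ratfun K) (n0 : nat) (T_repr : q_mult_repr q T D U n0)
    (U1 F V : ratfun K) (out : algorithm_output q D U n0 U1 F V) :
  (exists T1 T2 : nat -> K,
     [/\ q_hypergeometric q T1 /\ q_hypergeometric q T2,
         forall n, (n0 <= n)%N -> T n = T1 n.+1 - T1 n + T2 n,
         q_mult_repr q T1 D U1 n0 /\ q_mult_repr q T2 F V n0
       & eps_free q (denom V)]) /\
  (eps_reduced q D -> eps_reduced q F).
Proof.
case: out => U2 [u2 [loop [FE VE]]].
have [DE dm _] := ratfunP D; have d20 := monic_neq0 dm.
have [_ um _] := ratfunP U; have u0 := monic_neq0 um.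
have dD n : (n0 <= n)%N -> defined_at D (q ^+ n) by case/T_repr.
have dU n : (n0 <= n)%N -> defined_at U (q ^+ n) by case/T_repr.
(* Distances above the initial counter do not occur in [denom U], hence not in its residual part. *)
have inv0 : loop_invariant q D U n0 (qdis q (denom U) (denom U)) (0, U, denom U).
  split=> //; first by rewrite eps0 // mulr0 subr0 addr0.
    by move=> n _; have /evals_toP[] := evals_to0 (q ^+ n).
  move=> k /(qdis_lt q_neq0 q_not_root1 u0 u0)/separatedP sep.
  apply: separated_dvd (sep q_neq0).
  by rewrite div_mgcd_dvd // dvdp_mulr.
have [h h1 [uE U2E dU1 dU2 sep]] := for_loop_invariant q_neq0 dD inv0 loop.
have [U2f u2m _] := ratfunP U2; have u20 := monic_neq0 u2m.
set d2 := denom D in FE VE DE d20 *; set w := mgcd d2 (denom U2) in FE VE.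
have wd : w %| d2 := mgcd_dvdl _ _.
have wu : w %| denom U2 := mgcd_dvdr _ _.
have w0 : w != 0 by apply: mgcd_neq0.
have wn n : (n0 <= n)%N -> w.[q ^+ n] != 0.
  move=> /dD; rewrite /defined_at -/d2 -(divpK wd) hornerM mulf_eq0 negb_or.
  by case/andP.
rewrite -divp_mulA // in FE.
split; last by move=> red; rewrite FE; apply: eps_reduced_shift.
pose P n := \prod_(n0 <= j < n) value_at D (q ^+ j).
pose T1 n := value_at U1 (q ^+ n) * P n.
(* This choice makes the summation identity immediate; the content lies in representing [T2] by
   [(F, V)]. *)
pose T2 n := T n - (T1 n.+1 - T1 n).
have rep1 : q_mult_repr q T1 D U1 n0.
  by move=> n le; have [? ? _ _] := T_repr _ le; split=> //; apply: dU1.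
have eF n : (n0 <= n)%N -> evals_to F (q ^+ n)
    (value_at D (q ^+ n) * (w.[q ^+ n] / w.[q ^+ n.+1])).
  move=> le.
  have -> : F = D * (w%:F / (dilate q w)%:F).
    rewrite FE [D in RHS]DE -/d2 mulf_div -!tofracM; apply/eqP.
    rewrite eqr_div ?tofrac_eq0 ?mulf_neq0 ?dilate_eq0 ?divp_neq0 //.
    rewrite -!tofracM -[X in _ * (X * _)](divpK wd); apply/eqP; congr (_%:F); ring.
  apply: evals_toM; first exact/evals_to_value/dD.
  rewrite exprS -horner_dilate; apply: evals_to_frac.
  by rewrite horner_dilate -exprS wn // leqW.
have eV n : (n0 <= n)%N -> evals_to V (q ^+ n)
    (w.[q ^+ n0]^-1 * (value_at U2 (q ^+ n) * w.[q ^+ n])).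
  move=> le.
  have -> : V = (w.[q ^+ n0]^-1)%:P%:F * (U2 * w%:F).
    rewrite VE [U2 in RHS]U2f; congr (_ * _); apply: (canLR (mulfK _)).
      by rewrite tofrac_eq0 divp_neq0.
    by rewrite -mulrA -tofracM divpKC // divfK ?tofrac_eq0.
  apply: evals_toM.
    by have := evals_to_poly (w.[q ^+ n0]^-1)%:P (q ^+ n); rewrite hornerC.
  by apply: evals_toM; [exact/evals_to_value/dU2|exact: evals_to_poly].
have rep2 : q_mult_repr q T2 F V n0.
  move=> n le; have [_ vD _ TE] := T_repr _ le.
  have /evals_toP[dF vF] := eF _ le; have /evals_toP[dV vV] := eV _ le.
  have wn1 := wn _ (leqW le).
  split=> //; first by rewrite vF (mulf_neq0 vD (mulf_neq0 (wn _ le) (invr_neq0 wn1))).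
  (* The quotient [w(q^n0) / w(q^n)] cancels against the factors of [w] in the value of [V], which
     is why [V] is normalised by [w(q^n0)]. *)
  have -> : \prod_(n0 <= j < n) value_at F (q ^+ j) = P n * (w.[q ^+ n0] / w.[q ^+ n]).
    rewrite -(@prod_telescope _ _ (fun j => w.[q ^+ j])) //.
    by apply: eq_big_nat => j /andP[/eF/evals_toP[_ ->]].
  rewrite vV.
  have /evals_toP[_ ->] : evals_to U2 (q ^+ n) (value_at U (q ^+ n)
      - value_at D (q ^+ n) * value_at U1 (q ^+ n.+1) + value_at U1 (q ^+ n)).
    rewrite U2E; apply: evals_toD; last exact/evals_to_value/dU1.
    apply: evals_toD; first exact/evals_to_value/dU.
    apply/evals_toN/evals_toM; first exact/evals_to_value/dD.
    by apply: evals_to_eps => //; rewrite -exprS; apply/evals_to_value/dU1/leqW.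
  have PS : P n.+1 = P n * value_at D (q ^+ n) by rewrite /P big_nat_recr.
  rewrite /T2 /T1 TE -/(P n) PS.
  by field; rewrite !wn.
exists T1, T2; split.
- by split; apply: q_mult_repr_hypergeometric; eassumption.
- by move=> n _; rewrite /T2 addrC subrK.
- by [].
(* The constant in [V] goes to the numerator, so [denom V] divides [residual D u2], which is
   separated at every positive [k] because the exit counter is below [1]. *)
apply: eps_free_of_disjoint => k k0; apply/separatedP => //.
apply: (separated_dvd (v := residual D u2)); last first.
  by apply: sep; case: (h) h1 => //; lia.
have -> : residual D u2 = denom U2 %/ w by rewrite /residual uE mgcdC.
have -> : V = ((w.[q ^+ n0]^-1)%:P * numer U2)%:F / (denom U2 %/ w)%:F.
  by rewrite VE mulrA tofracM.
exact/denom_frac_dvd/divp_neq0.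
Qed.
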